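(* Let $R$ be a finite Frobenius ring. Then the semigroup determinant of the multiplicative monoid of $R$ is nonzero; that is, the determinant of the $R\times R$ matrix with $(r,s)$-entry the variable $x_{rs}$ is a nonzero polynomial in $\mathbb C[x_r\mid r\in R]$.
   Context: A finite unital (not necessarily commutative) ring $R$ is Frobenius if it is self-injective and $R/J(R)$ is isomorphic to the left socle of $R$ as a left $R$-module, where $J(R)$ is the Jacobson radical. *)

(* Defs.v *)
From HB Require Import structures.
From mathcomp Require Import all_boot all_algebra.
From mathcomp Require Import mpoly.

Set Implicit Arguments.
Unset Strict Implicit.
Unset Printing Implicit Defensive.

Import GRing.Theory.
Local Open Scope ring_scope.
Local Open Scope quotient_scope.

Section QuotientModule.
Variables (R : pzRingType) (V : lmodType R) (W : submodClosed V).

Definition lmod_zmodClosed : zmodClosed V :=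
  HB.pack (W : {pred V})
    (GRing.isZmodClosed.Build V (W : {pred V})
       (GRing.submod_closedB (submodClosedP W))).

Definition lmod_quot : Type := Quotient.quot lmod_zmodClosed.

HB.instance Definition _ := GRing.Zmodule.on lmod_quot.

Definition lmod_proj (v : V) : lmod_quot := \pi_(Quotient.quot lmod_zmodClosed) v.

Definition lmod_quot_scale (a : R) (q : lmod_quot) : lmod_quot :=
  lmod_proj (a *: repr (q : Quotient.quot lmod_zmodClosed)).

Lemma lmod_proj_eq (u v : V) : (lmod_proj u == lmod_proj v) = (u - v \in W).
Proof. by rewrite /lmod_proj eqmodE. Qed.

Lemma lmod_projK (q : lmod_quot) :
  lmod_proj (repr (q : Quotient.quot lmod_zmodClosed)) = q.
Proof. exact: reprK. Qed.

Lemma lmod_projD : {morph lmod_proj : u v / u + v}.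
Proof. by move=> u v; rewrite /lmod_proj [LHS]Quotient.pi_add. Qed.

Lemma lmod_projZ (a : R) (v : V) :
  lmod_proj (a *: v) = lmod_quot_scale a (lmod_proj v).
Proof.
apply/eqP; rewrite lmod_proj_eq -scalerBr rpredZ //.
by rewrite -lmod_proj_eq lmod_projK.
Qed.

Fact lmod_quot_scaleA a b q :
  lmod_quot_scale a (lmod_quot_scale b q) = lmod_quot_scale (a * b) q.
Proof. by rewrite -(lmod_projK q) -!lmod_projZ scalerA. Qed.

Fact lmod_quot_scale1 : left_id 1 lmod_quot_scale.
Proof. by move=> q; rewrite -(lmod_projK q) -lmod_projZ scale1r. Qed.

Fact lmod_quot_scaleDr : right_distributive lmod_quot_scale +%R.
Proof.
move=> a p q; rewrite -(lmod_projK p) -(lmod_projK q).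
by rewrite -lmod_projD -!lmod_projZ scalerDr lmod_projD.
Qed.

Fact lmod_quot_scaleDl q : {morph lmod_quot_scale^~ q : a b / a + b}.
Proof.
move=> a b /=; rewrite -(lmod_projK q) -!lmod_projZ.
by rewrite scalerDl lmod_projD.
Qed.

HB.instance Definition _ := GRing.Zmodule_isLmodule.Build R lmod_quot
  lmod_quot_scaleA lmod_quot_scale1 lmod_quot_scaleDr lmod_quot_scaleDl.

End QuotientModule.

Definition injective_module (R : pzRingType) (E : lmodType R) : Prop :=
  forall (M N : lmodType R) (f : {linear M -> N}) (g : {linear M -> E}),
    injective f -> exists h : {linear N -> E}, forall x, h (f x) = g x.

Section FiniteRing.
Variable R : finPzRingType.
Implicit Types I : {set R}.

Definition left_ideal I : bool :=
  (0 \in I) && [forall a, forall x in I, forall y in I, a * x + y \in I].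

Lemma left_idealP I :
  reflect (GRing.submod_closed (mem I : {pred R^o})) (left_ideal I).
Proof.
apply: (iffP andP) => -[I0 IL]; split=> //.
  by move=> a x y xI yI; have/forallP/(_ a)/forall_inP/(_ x xI)/forall_inP := IL;
     apply.
apply/forallP => a; apply/forall_inP => x xI; apply/forall_inP => y yI.
exact: (IL a x y xI yI).
Qed.

Definition maximal_left_ideal I : bool :=
  maxset (fun J => left_ideal J && (J != [set: R])) I.

Definition minimal_left_ideal I : bool :=
  minset (fun J => left_ideal J && (J != [set 0])) I.

Definition jacobson_radical : {pred R^o} :=
  fun x : R => [forall I, maximal_left_ideal I ==> (x \in I)].

(* An element of the sum of all minimal left ideals is a sum of one term f I
   from each minimal left ideal I. *)
Definition left_socle : {pred R^o} :=
  fun x : R => [exists f : {ffun {set R} -> R},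
    [forall I, minimal_left_ideal I ==> (f I \in I)]
      && (x == \sum_(I | minimal_left_ideal I) f I)].

Fact jacobson_radical_submod_closed : GRing.submod_closed jacobson_radical.
Proof.
split=> [|a x y /forallP/= xJ /forallP/= yJ].
  apply/forallP => I; apply/implyP => /maxsetp/andP[/left_idealP[]].
  by [].
apply/forallP => I; apply/implyP => maxI.
have /andP[/left_idealP[_ IL] _] := maxsetp maxI.
by apply: IL; [exact: (implyP (xJ I)) | exact: (implyP (yJ I))].
Qed.

Fact left_socle_submod_closed : GRing.submod_closed left_socle.
Proof.
split=> [|a x y /existsP[f /andP[/forallP/= fI /eqP->]]].
  apply/existsP; exists [ffun=> 0]; apply/andP; split.
    apply/forallP => I; apply/implyP => /minsetp/andP[/left_idealP[I0 _] _].
    by rewrite ffunE.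
  by rewrite big1 // => I _; rewrite ffunE.
move=> /existsP[g /andP[/forallP/= gI /eqP->]].
apply/existsP; exists [ffun I => a * f I + g I]; apply/andP; split.
  apply/forallP => I; apply/implyP => minI; rewrite ffunE.
  have /andP[/left_idealP[_ IL] _] := minsetp minI.
  by apply: IL; [exact: (implyP (fI I)) | exact: (implyP (gI I))].
rewrite [a *: _]mulr_sumr -big_split /=; apply/eqP.
by apply: eq_bigr => I _; rewrite ffunE.
Qed.

HB.instance Definition _ :=
  GRing.isSubmodClosed.Build R R^o jacobson_radical
    jacobson_radical_submod_closed.
HB.instance Definition _ :=
  GRing.isSubmodClosed.Build R R^o left_socle left_socle_submod_closed.

Definition left_socle_module : Type := {x : R^o | x \in left_socle}.

HB.instance Definition _ := SubChoice.on left_socle_module.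
HB.instance Definition _ :=
  [SubChoice_isSubLmodule of left_socle_module by <:].

(* Only left self-injectivity is required; for a finite ring it is equivalent
   to right self-injectivity. *)
Definition frobenius_ring : Prop :=
  injective_module (R^o : lmodType R)
  /\ exists f : {linear lmod_quot jacobson_radical -> left_socle_module},
       bijective f.

End FiniteRing.

(* The variable x_s is 'X_(enum_rank s). Rows and columns are listed in the
   same order, so the determinant does not depend on that order up to the
   renaming of the variables. *)
Definition semigroup_matrix (C : comNzRingType) (S : finType)
    (op : S -> S -> S) : 'M[{mpoly C[#|S|]}]_#|S| :=
  \matrix_(i, j) 'X_(enum_rank (op (enum_val i) (enum_val j))).

Definition semigroup_determinant (C : comNzRingType) (S : finType)
    (op : S -> S -> S) : {mpoly C[#|S|]} :=
  \det (semigroup_matrix C op).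

(* Main.v *)
(* The determinant becomes nonzero under x_r := chi(r) for an additive character
   chi of R whose kernel contains no nonzero left ideal: the columns
   r |-> chi(r * s) are then pairwise distinct characters of (R, +), hence
   orthogonal.  Such a chi is built on the left socle, which meets every nonzero
   left ideal, and extended to R.  Through the isomorphism of the socle with
   A = R/J(R), it is enough to treat A.  There 1 is a sum of orthogonal
   idempotents e with A e a minimal left ideal, and
   a |-> \prod_e psi_e(e * a * e) has no nonzero left ideal in its kernel as soon
   as psi_e(e) != 1 for all e: if a * e != 0, then d * a * e = e for some d, and
   e * d * a is sent to psi_e(e).  The characters take their values in algC,
   which is harmless because the determinant has integer coefficients. *)
From HB Require Import structures.
Require Import Defs.
From mathcomp Require Import all_boot all_algebra all_fingroup all_field.
From mathcomp Require Import all_character.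
From mathcomp Require Import reals complex mpoly.

Set Implicit Arguments.
Unset Strict Implicit.
Unset Printing Implicit Defensive.

Import GRing.Theory Num.Theory.
Local Open Scope ring_scope.

(** * Characters of finite abelian groups *)

Definition additive_character (V : zmodType) (chi : V -> algC) : Prop :=
  chi 0 = 1 /\ {morph chi : x y / x + y >-> x * y}.

Section AdditiveCharacters.
Variable V : finZmodType.

Let abelV : abelian [set: V]. Proof. exact: FinRing.zmod_abelian. Qed.

Lemma additive_character_irr (i : Iirr [set: V]) :
  additive_character ('chi_i : V -> algC).
Proof.
have lin_i : 'chi_i \is a linear_char by exact/char_abelianP.
split=> [|x y]; first exact: lin_char1.
exact: lin_charM.
Qed.

Lemma additive_character_separates (a : V) :
  a != 0 -> exists2 chi, additive_character chi & chi a != 1.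
Proof.
move=> a_neq0.
suff /existsP[i chi_a] : [exists i : Iirr [set: V], 'chi_i a != 1].
  by exists 'chi_i => //; apply: additive_character_irr.
apply: contraR a_neq0 => /existsPn/= chi_a.
suff: a \in \bigcap_(i : Iirr [set: V]) cfker 'chi_i.
  by rewrite TI_cfker_irr => /set1gP->.
apply/bigcapP=> i _; rewrite cfkerEirr inE.
have [-> _] := additive_character_irr i.
by have /negPn/eqP-> := chi_a i.
Qed.

(** On [H], [lambda] is a linear character of a subgroup. A constituent of its induction to [V] is
    linear because [V] is abelian, so by Frobenius reciprocity it restricts to [lambda] on [H]. *)
Lemma additive_character_extension (H : {pred V}) (lambda : V -> algC) :
    zmod_closed H -> lambda 0 = 1 ->
    {in H &, {morph lambda : x y / x + y >-> x * y}} ->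
  exists2 chi, additive_character chi & {in H, chi =1 lambda}.
Proof.
move=> [H0 HB] lambda0 lambdaD.
have gH : group_set [set x in H].
  apply/group_setP; split=> [|x y]; rewrite !inE // => Hx Hy.
  by rewrite FinRing.zmodMgE -[y]opprK HB // -[- y]sub0r HB.
have lambda_repr : mx_repr (Group gH) (fun x => (lambda x)%:M : 'M_1).
  split=> [|x y /[!inE] Hx Hy]; first by rewrite lambda0.
  by rewrite -scalar_mxM -lambdaD.
pose rho := cfRepr (MxRepresentation lambda_repr).
have rhoE : {in Group gH, rho =1 lambda}.
  by move=> x Hx; rewrite cfunE Hx /= mxtrace_scalar.
have lin_rho : rho \is a linear_char.
  apply/andP; split; first exact: cfRepr_char.
  by apply/eqP; rewrite rhoE ?group1.
have [j rho_j] := irrP (lin_char_irr lin_rho).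
have sHV : Group gH \subset [set: V] by exact: subsetT.
have [i ij] := constt_cfInd_irr j sHV; move: ij; rewrite constt_Ind_Res.
have lin_i : 'chi_i \is a linear_char by exact/char_abelianP.
have [k Dk] := irrP (lin_char_irr (cfRes_lin_char (Group gH) lin_i)).
rewrite Dk constt_irr inE => /eqP Dj.
exists 'chi_i; first exact: additive_character_irr.
by move=> x Hx; rewrite -rhoE ?inE // rho_j Dj -Dk cfResE ?inE.
Qed.

End AdditiveCharacters.

(** * Primitive idempotents in a finite ring with zero Jacobson radical *)

Section PrimitiveIdempotents.
Variable A : finPzRingType.
Implicit Types a b c d e f : A.

(* [A * a] is a minimal left ideal. *)
Definition left_minimal a : bool :=
  (a != 0) && [forall b, (b * a != 0) ==> [exists c, c * (b * a) == a]].

Lemma left_minimalP a :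
  reflect (a != 0 /\ forall b, b * a != 0 -> exists c, c * (b * a) = a)
          (left_minimal a).
Proof.
apply: (iffP andP) => -[a0 min_a]; split=> //.
  by move=> b /(implyP (forallP min_a b))/existsP[c /eqP]; exists c.
apply/forallP=> b; apply/implyP=> /min_a[c ca].
by apply/existsP; exists c; apply/eqP.
Qed.

(** By finiteness, [b] can be chosen so that the nonzero left ideal [A * b * a] has least size. *)
Lemma left_minimal_multiple a : a != 0 -> exists b, left_minimal (b * a).
Proof.
move=> a0; have P1 : 1 * a != 0 by rewrite mul1r.
case: (arg_minnP (P := fun b => b * a != 0)
        (fun b => #|[set c * (b * a) | c in [set: A]]|) P1) => b ba0 min_b.
exists b; apply/left_minimalP; split=> // d dba0.
have sub : [set c * (d * b * a) | c in [set: A]]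
             \subset [set c * (b * a) | c in [set: A]].
  apply/subsetP=> _ /imsetP[c _ ->].
  by apply/imsetP; exists (c * d); rewrite ?mulrA.
have : b * a \in [set c * (b * a) | c in [set: A]].
  by apply/imsetP; exists 1; rewrite ?inE ?mul1r.
have/eqP<- : [set c * (d * b * a) | c in [set: A]]
             == [set c * (b * a) | c in [set: A]].
  by rewrite eqEcard sub min_b // -mulrA.
by case/imsetP=> c _ Ec; exists c; rewrite mulrA -mulrA (mulrA d).
Qed.

(** The Jacobson radical consists of the [a] for which every [1 - c * a] has a left inverse, so this
    says that it is zero. *)
Hypothesis radical0 :
  forall a, a != 0 -> exists c, forall u, u * (1 - c * a) != 1.

Lemma left_minimal_idempotent a : left_minimal a ->
  exists c, left_minimal (c * a) /\ c * a * (c * a) = c * a.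
Proof.
move=> /left_minimalP[a0 min_a]; have [c nunit] := radical0 a0; exists c.
(* Otherwise minimality gives [d] with [d * (a - a * (c * a)) = a], and then [c * d * a + 1] is a
   left inverse of [1 - c * a]. *)
have aca : a * (c * a) = a.
  apply/eqP; rewrite eq_sym -subr_eq0; apply/negPn/negP => af0.
  have Eaf : a - a * (c * a) = (1 - a * c) * a by rewrite mulrBl mul1r mulrA.
  rewrite Eaf in af0; have [d Da] := min_a _ af0.
  have /eqP[] := nunit (c * d * a + 1).
  rewrite mulrDl mul1r -[c * d * a * _]mulrA mulrBr mulr1 Eaf -!mulrA.
  by rewrite Da addrC subrK.
split=> //; last by rewrite -mulrA aca.
apply/left_minimalP; split=> [|b].
  by apply: contraNneq a0 => ca0; rewrite -aca ca0 mulr0.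
move=> bca0; have /min_a[d Da] : b * c * a != 0 by rewrite -mulrA.
by exists (c * d); rewrite -mulrA (mulrA b) Da.
Qed.

(** The left ideal [A * f] contains a minimal idempotent [g], so [g * f = g]. Passing to [f * g]
    keeps it minimal and idempotent and makes [f] fix it on both sides. *)
Lemma left_minimal_idempotent_corner f : f != 0 -> f * f = f ->
  exists g, [/\ left_minimal g, g * g = g, f * g = g & g * f = g].
Proof.
move=> f0 ff; have [b min_bf] := left_minimal_multiple f0.
have [c [/left_minimalP[g0 min_g] gg]] := left_minimal_idempotent min_bf.
set g := c * _ in g0 min_g gg *.
have gf : g * f = g by rewrite /g -!mulrA ff.
have gfg : g * (f * g) = g by rewrite mulrA gf.
exists (f * g); split.
- apply/left_minimalP; split=> [|d].
    by apply: contraNneq g0 => fg0; rewrite -gfg fg0 mulr0.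
  rewrite mulrA => /min_g[h Dg]; exists (f * h).
  by rewrite -[in RHS]Dg !mulrA.
- by rewrite -mulrA gfg.
- by rewrite mulrA ff.
- by rewrite -mulrA gf.
Qed.

Definition orthogonal_idempotents (E : {set A}) : bool :=
  [forall e in E, left_minimal e] &&
  [forall e in E, forall f in E, e * f == (if e == f then e else 0)].

Lemma orthogonal_idempotentsP (E : {set A}) :
  reflect ({in E, forall e, left_minimal e} /\
           {in E &, forall e f, e * f = if e == f then e else 0})
          (orthogonal_idempotents E).
Proof.
apply: (iffP andP) => -[minE orthE]; split; try exact/forall_inP.
  move=> e f eE fE; apply/eqP.
  by move/forall_inP/(_ e eE)/forall_inP/(_ f fE): orthE.
apply/forall_inP=> e eE; apply/forall_inP=> f fE; apply/eqP; exact: orthE.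
Qed.

(** A maximal orthogonal set works: if its sum [s] were not [1], the corner of the idempotent
    [1 - s] would contain one more minimal idempotent, orthogonal to the whole set. *)
Lemma left_minimal_idempotent_decomposition :
  exists2 E : {set A}, orthogonal_idempotents E & \sum_(e in E) e = 1.
Proof.
have P0 : orthogonal_idempotents set0.
  by apply/orthogonal_idempotentsP; split=> e; rewrite inE.
have [E /maxsetP[PE maxE] _] := maxset_exists P0.
have /orthogonal_idempotentsP[minE orthE] := PE; exists E => //.
set s := \sum_(e in E) e.
have sl e : e \in E -> s * e = e.
  move=> eE; rewrite mulr_suml (bigD1 e) //= orthE // eqxx big1 ?addr0 // => f.
  by case/andP=> fE fe; rewrite orthE // (negPf fe).
have sr e : e \in E -> e * s = e.
  move=> eE; rewrite mulr_sumr (bigD1 e) //= orthE // eqxx big1 ?addr0 // => f.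
  by case/andP=> fE fe; rewrite orthE // eq_sym (negPf fe).
have ss : s * s = s by rewrite {2 3}/s mulr_sumr; apply: eq_bigr.
apply/eqP; rewrite eq_sym -subr_eq0; apply/negPn/negP=> f0.
have ff : (1 - s) * (1 - s) = 1 - s.
  by rewrite mulrBl mul1r mulrBr mulr1 ss subrr subr0.
have [g [min_g gg fg gf]] := left_minimal_idempotent_corner f0 ff.
have ge e : e \in E -> g * e = 0.
  by move=> eE; rewrite -gf -mulrA mulrBl mul1r sl // subrr mulr0.
have eg e : e \in E -> e * g = 0.
  by move=> eE; rewrite -fg mulrA mulrBr mulr1 sr // subrr mul0r.
have g0 : g != 0 by have /left_minimalP[] := min_g.
have gE : g \notin E by apply: contraNN g0 => /ge; rewrite gg => ->.
suff /maxE/(_ (subsetU1 _ _)) EE : orthogonal_idempotents (g |: E).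
  by rewrite -EE setU11 in gE.
apply/orthogonal_idempotentsP; split=> [e /setU1P[->|/minE]//|e h].
case/setU1P=> [->|eE] /setU1P[->|hE]; last exact: orthE.
- by rewrite gg eqxx.
- by rewrite ge //; case: eqP gE => // ->; rewrite hE.
- by rewrite eg //; case: eqP gE => // <-; rewrite eE.
Qed.

Lemma semisimple_generating_character :
  exists2 chi, additive_character chi
    & forall a, a != 0 -> exists b, chi (b * a) != 1.
Proof.
have [E /orthogonal_idempotentsP[minE orthE] sumE] :=
  left_minimal_idempotent_decomposition.
have psiP e : exists psi, additive_character psi /\ (e != 0 -> psi e != 1).
  (* The trivial character at [e = 0] only makes the choice of [psi] total; members of [E] are
     nonzero. *)
  have [->|e0] := eqVneq e 0; last first.
    by have [psi] := additive_character_separates e0; exists psi.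
  by exists (fun=> 1); do 2?split=> //; move=> x y; rewrite mulr1.
have [psi Hpsi] := fin_all_exists psiP.
have psi0 e : psi e 0 = 1 by case: (Hpsi e) => -[].
exists (fun a => \prod_(e in E) psi e (e * a * e)).
  split=> [|a b]; first by rewrite big1 // => e _; rewrite mulr0 mul0r.
  rewrite -big_split; apply: eq_bigr=> e _ /=.
  by have [[_ psiD] _] := Hpsi e; rewrite mulrDr mulrDl psiD.
move=> a a0; have [e eE ae0] : exists2 e, e \in E & a * e != 0.
  apply/exists_inP; apply: contraR a0 => /exists_inPn ae0.
  rewrite -[a]mulr1 -sumE mulr_sumr big1 // => e eE.
  by apply/eqP/negPn/ae0.
have /left_minimalP[e0 min_e] := minE e eE.
have ee : e * e = e by rewrite orthE ?eqxx.
have /min_e[d Dae] : a * e * e != 0 by rewrite -mulrA ee.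
rewrite -[a * e * e]mulrA ee in Dae.
(* The [e] on the left isolates one factor of the product: for [f != e], [f * e = 0] and
   [psi f 0 = 1]. *)
exists (e * d); rewrite (bigD1 e) //= big1 ?mulr1 => [|f /andP[fE fe]].
  have -> : e * (e * d * a) * e = e by rewrite -!mulrA Dae !ee.
  by have [_] := Hpsi e; apply.
by rewrite !mulrA (orthE f e) // (negPf fe) !mul0r.
Qed.

End PrimitiveIdempotents.

(** * The Jacobson radical and the quotient ring by it *)

Section JacobsonQuotient.
Variable R : finPzRingType.
Implicit Types (x a b c : R) (I : {set R}).
Local Notation J := (@jacobson_radical R).

Lemma left_ideal_mul I a x : left_ideal I -> x \in I -> a * x \in I.
Proof.
move=> /left_idealP[I0 IL] xI.
by have := IL a x 0 xI I0; rewrite addr0.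
Qed.

Lemma left_ideal_add I x y : left_ideal I -> x \in I -> y \in I -> x + y \in I.
Proof.
move=> /left_idealP[_ IL] xI yI.
have Ixy := IL 1 x y xI yI; rewrite scale1r in Ixy; exact: Ixy.
Qed.

Lemma left_ideal_principal x : left_ideal [set c * x | c in [set: R]].
Proof.
apply/left_idealP; split=> [|a _ _ /imsetP[b _ ->] /imsetP[c _ ->]].
  by apply/imsetP; exists 0; rewrite ?mul0r.
by apply/imsetP; exists (a * b + c); rewrite // mulrDl -mulrA.
Qed.

Lemma left_ideal_sum I1 I2 : left_ideal I1 -> left_ideal I2 ->
  left_ideal [set x + y | x in I1, y in I2].
Proof.
move=> /left_idealP[I10 IL1] /left_idealP[I20 IL2]; apply/left_idealP; split.
  by apply/imset2P; exists 0 0; rewrite ?addr0.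
move=> a _ _ /imset2P[x1 y1 x1I y1I ->] /imset2P[x2 y2 x2I y2I ->].
apply/imset2P; exists (a * x1 + x2 : R) (a * y1 + y2 : R).
- exact: IL1.
- exact: IL2.
by rewrite [_ *: _]mulrDr addrACA.
Qed.

Lemma maximal_left_ideal_one I : maximal_left_ideal I -> 1 \notin I.
Proof.
move=> /maxsetp/andP[idI]; apply: contraNN => I1; apply/eqP/setP=> x.
by rewrite inE -[x]mulr1 left_ideal_mul.
Qed.

Lemma maximal_left_ideal_coprime I x : maximal_left_ideal I -> x \notin I ->
  exists c, 1 - c * x \in I.
Proof.
move=> maxI xI; have /andP[idI _] := maxsetp maxI.
have [I0 _] := left_idealP _ idI.
pose K := [set y + z | y in I, z in [set c * x | c in [set: R]]].
have idK : left_ideal K by apply/left_ideal_sum/left_ideal_principal.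
have sIK : I \subset K.
  apply/subsetP=> y yI; apply/imset2P; exists y 0; rewrite ?addr0 //.
  by apply/imsetP; exists 0; rewrite ?mul0r.
have xK : x \in K.
  apply/imset2P; exists 0 x; rewrite ?add0r //.
  by apply/imsetP; exists 1; rewrite ?mul1r.
have /imset2P[y _ yI /imsetP[c _ ->] E1] : 1 \in K.
  suff /eqP-> : K == setT by rewrite inE.
  apply: contraNT xI => KT; have /maxsetP[_ /(_ K)<- //] := maxI.
  exact/andP.
by exists c; rewrite E1 addrK.
Qed.

(** If [1 - c * x] has no left inverse, it lies in a maximal left ideal, which cannot also contain
    [x]. Conversely, if a maximal left ideal misses [x], it contains some [1 - c * x], which then
    has no left inverse. *)
Lemma jacobson_radicalP x :
  reflect (forall c, exists u, u * (1 - c * x) = 1) (x \in J).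
Proof.
apply: (iffP idP) => [xJ c|unit_x].
  apply/'exists_eqP; apply: contraPT xJ => /existsPn/= nunit.
  pose I0 := [set u * (1 - c * x) | u in [set: R]].
  have pI0 : left_ideal I0 && (I0 != [set: R]).
    rewrite left_ideal_principal; apply: contraTneq isT => I0T.
    have /imsetP[u _ E1] : 1 \in I0 by rewrite I0T inE.
    by have := nunit u; rewrite -E1 eqxx.
  have [I maxI /subsetP sI0I] :=
    maxset_exists (P := fun I => left_ideal I && (I != [set: R])) pI0.
  move=> /forallP/(_ I)/implyP/(_ maxI) xI.
  have /negP := maximal_left_ideal_one maxI; apply.
  have /andP[idI _] := maxsetp maxI.
  rewrite -[1](subrK (c * x)) left_ideal_add ?left_ideal_mul // sI0I //.
  by apply/imsetP; exists 1; rewrite ?mul1r.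
apply/forallP=> I; apply/implyP=> maxI.
have /andP[idI _] := maxsetp maxI.
apply: contraT => /(maximal_left_ideal_coprime maxI)[c cxI].
have [u E1] := unit_x c.
by have := maximal_left_ideal_one maxI; rewrite -E1 left_ideal_mul.
Qed.

(** This makes [J] two-sided. The witness is the usual passage from a left inverse [u] of
    [1 - a * (c * x)] to one of [1 - (c * x) * a]. *)
Lemma jacobson_radical_mulr x a : x \in J -> x * a \in J.
Proof.
move=> /jacobson_radicalP unit_x; apply/jacobson_radicalP=> c.
have [u Eu] := unit_x (a * c); exists (1 + c * x * u * a).
have -> : (1 + c * x * u * a) * (1 - c * (x * a))
        = 1 - c * x * a + c * x * (u * (1 - a * c * x)) * a.
  by rewrite mulrDl mul1r !mulrBr !mulr1 mulrBl !mulrA.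
by rewrite Eu mulr1 subrK.
Qed.

Definition jacobson_quotient : Type := lmod_quot J.

HB.instance Definition _ := GRing.Lmodule.on jacobson_quotient.

Definition jacobson_proj : R -> jacobson_quotient := @lmod_proj R R^o J.

Let rp (q : jacobson_quotient) : R :=
  generic_quotient.repr (q : Quotient.quot (lmod_zmodClosed J)).

Let rpK : cancel rp jacobson_proj.
Proof. exact: lmod_projK. Qed.

HB.instance Definition _ : isCountable jacobson_quotient := CanIsCountable rpK.
HB.instance Definition _ : isFinite jacobson_quotient := CanIsFinite rpK.

Lemma jacobson_proj_surj (q : jacobson_quotient) :
  exists x, jacobson_proj x = q.
Proof. by exists (rp q). Qed.

Lemma jacobson_proj_eq x y : jacobson_proj x = jacobson_proj y <-> x - y \in J.
Proof. by split=> [/eqP|xyJ]; [|apply/eqP]; rewrite lmod_proj_eq. Qed.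

Definition jacobson_quotient_mul (p q : jacobson_quotient) : jacobson_quotient :=
  jacobson_proj (rp p * rp q).

(** The product does not depend on the chosen representatives; the term [(x - x') * y] is where [J]
    has to be a right ideal. *)
Lemma jacobson_projM x y :
  jacobson_proj (x * y) =
    jacobson_quotient_mul (jacobson_proj x) (jacobson_proj y).
Proof.
apply/jacobson_proj_eq; set x' := rp _; set y' := rp _.
have -> : x * y - x' * y' = (x - x') * y + x' * (y - y').
  by rewrite mulrBl mulrBr addrA subrK.
apply: (@rpredD _ J).
  by apply/jacobson_radical_mulr/jacobson_proj_eq; rewrite rpK.
by apply: (@rpredZ _ _ J x'); apply/jacobson_proj_eq; rewrite rpK.
Qed.

Lemma jacobson_projD : {morph jacobson_proj : x y / x + y}.
Proof. move=> x y; exact: (@lmod_projD R R^o J x y). Qed.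

Fact jacobson_quotient_mulA : associative jacobson_quotient_mul.
Proof.
move=> p q r; rewrite -(rpK p) -(rpK q) -(rpK r).
by rewrite -!jacobson_projM mulrA.
Qed.

Fact jacobson_quotient_mul1q : left_id (jacobson_proj 1) jacobson_quotient_mul.
Proof. by move=> p; rewrite -(rpK p) -jacobson_projM mul1r. Qed.

Fact jacobson_quotient_mulq1 : right_id (jacobson_proj 1) jacobson_quotient_mul.
Proof. by move=> p; rewrite -(rpK p) -jacobson_projM mulr1. Qed.

Fact jacobson_quotient_mulDl : left_distributive jacobson_quotient_mul +%R.
Proof.
move=> p q r; rewrite -(rpK p) -(rpK q) -(rpK r).
by rewrite -jacobson_projD -!jacobson_projM mulrDl jacobson_projD.
Qed.

Fact jacobson_quotient_mulDr : right_distributive jacobson_quotient_mul +%R.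
Proof.
move=> p q r; rewrite -(rpK p) -(rpK q) -(rpK r).
by rewrite -jacobson_projD -!jacobson_projM mulrDr jacobson_projD.
Qed.

HB.instance Definition _ := GRing.Zmodule_isPzRing.Build jacobson_quotient
  jacobson_quotient_mulA jacobson_quotient_mul1q jacobson_quotient_mulq1
  jacobson_quotient_mulDl jacobson_quotient_mulDr.

(** Left inverses lift modulo [J], so a [c] witnessing [x \notin J] in [R] still works in the
    quotient. *)
Lemma jacobson_quotient_radical0 (a : jacobson_quotient) : a != 0 ->
  exists c : jacobson_quotient, forall u, u * (1 - c * a) != 1.
Proof.
rewrite -(rpK a); set x := rp a => xJ.
have {}xJ : x \notin J.
  apply: contraNN xJ => xJ; apply/eqP.
  have -> : (0 : jacobson_quotient) = jacobson_proj 0.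
    by apply: (addrI (jacobson_proj 0)); rewrite addr0 -jacobson_projD addr0.
  by apply/jacobson_proj_eq; rewrite subr0.
suff [c nunit] : exists c, forall u, u * (1 - c * x) != 1.
  exists (jacobson_proj c) => u; rewrite -(rpK u).
  have -> : 1 - jacobson_proj c * jacobson_proj x = jacobson_proj (1 - c * x).
    apply: (addIr (jacobson_proj c * jacobson_proj x)); rewrite subrK.
    by rewrite -[jacobson_proj c * _]jacobson_projM -jacobson_projD subrK.
  rewrite -[_ * _]jacobson_projM; apply/eqP=> /jacobson_proj_eq.
  (* An element congruent to [1] modulo [J] has a left inverse [v]; the constant [-1] turns
     [1 - c * x] of the criterion into that element. *)
  move=> /jacobson_radicalP/(_ (-1))[v]; rewrite mulN1r opprK addrC subrK.
  by rewrite mulrA => /eqP; apply/negP/nunit.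
suff /existsP[c /forallP nunit] : [exists c, [forall u, u * (1 - c * x) != 1]].
  by exists c.
apply: contraNT xJ => /existsPn/= unit_x; apply/jacobson_radicalP=> c.
by have := unit_x c; rewrite negb_forall => /existsP[u /negPn/eqP]; exists u.
Qed.

End JacobsonQuotient.

(** * The generating character and its matrix *)

Section GeneratingCharacter.
Variable R : finPzRingType.

(** By finiteness [R * s] contains a minimal left ideal, any nonzero element of which serves. *)
Lemma left_socle_multiple (s : R) : s != 0 ->
  exists r, r * s != 0 /\ r * s \in @left_socle R.
Proof.
move=> s0; pose Rs := [set c * s | c in [set: R]].
have sRs : s \in Rs by apply/imsetP; exists 1; rewrite ?mul1r.
have pRs : left_ideal Rs && (Rs != [set 0]).
  rewrite left_ideal_principal; apply: contraNneq s0 => Rs0.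
  by move: sRs; rewrite Rs0 inE.
have [I minI sIRs] :=
  minset_exists (P := fun I => left_ideal I && (I != [set 0])) pRs.
have /andP[/left_idealP[I0 _] In0] := minsetp minI.
have [t tI t0] : exists2 t, t \in I & t != 0.
  apply/exists_inP; apply: contraR In0 => /exists_inPn It.
  rewrite eqEsubset sub1set I0 andbT; apply/subsetP=> t /It.
  by rewrite negbK inE.
have /imsetP[r _ Dt] := subsetP sIRs t tI; exists r; rewrite -Dt; split=> //.
apply/existsP; exists [ffun I' => if I' == I then t else 0]; apply/andP; split.
  apply/forallP=> I'; apply/implyP=> /minsetp/andP[/left_idealP[I'0 _] _].
  by rewrite ffunE; case: eqP => [->|].
rewrite (bigD1 I) //= ffunE eqxx big1 ?addr0 // => I' /andP[_ /negPf I'I].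
by rewrite ffunE I'I.
Qed.

(** This lets the [R]-linear isomorphism with the socle carry ring multiplication in the quotient to
    scaling in the socle. *)
Lemma jacobson_proj_mul (x : R) (q : jacobson_quotient R) :
  jacobson_proj x * q = x *: (q : lmod_quot (@jacobson_radical R)).
Proof.
have [y <-] := jacobson_proj_surj q.
rewrite -[LHS]jacobson_projM; exact: (@lmod_projZ R R^o _ x y).
Qed.

Lemma frobenius_generating_character : frobenius_ring R ->
  exists2 chi, additive_character chi
    & forall s : R, s != 0 -> exists r, chi (r * s) != 1.
Proof.
case=> _ [f [g fK gK]].
have [lambda [lambda0 lambdaD] lambda_gen] :=
  semisimple_generating_character (@jacobson_quotient_radical0 R).
have gD u v : g (u + v) = g u + g v.
  by apply: (can_inj fK); rewrite linearD !gK.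
have gZ (r : R) u : g (r *: u) = r *: g u.
  by apply: (can_inj fK); rewrite linearZ /= !gK.
(* Off the socle [insubd] falls back to [0]; only the values on the socle matter. *)
pose theta (x : R) : jacobson_quotient R := g (insubd 0 (x : R^o)).
have theta_val (u : left_socle_module R) : theta (val u) = g u.
  by rewrite /theta valKd.
have thetaD : {in @left_socle R &, {morph theta : x y / x + y}}.
  move=> x y Hx Hy.
  pose u : left_socle_module R := Sub (x : R^o) Hx.
  pose v : left_socle_module R := Sub (y : R^o) Hy.
  rewrite -[x]/(val u) -[y]/(val v) -[val u + val v]/(val (u + v)).
  by rewrite !theta_val gD.
have theta0 : theta 0 = 0.
  have H0 : 0 \in @left_socle R by exact: (@rpred0 _ (@left_socle R)).
  by apply: (addrI (theta 0)); rewrite -thetaD // !addr0.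
have [chi chi_add chiE] : exists2 chi, additive_character chi
    & {in @left_socle R, chi =1 lambda \o theta}.
  apply: additive_character_extension => [||x y Hx Hy] /=.
  - exact: GRing.submod_closedB (left_socle_submod_closed R).
  - by rewrite theta0.
  - by rewrite thetaD.
exists chi => // s /left_socle_multiple[r [rs0 Hrs]].
pose u : left_socle_module R := Sub (r * s : R^o) Hrs.
have gu0 : (g u : jacobson_quotient R) != 0.
  apply: contraNneq rs0 => gu0.
  have u0 : u = 0 by rewrite -(gK u) gu0 linear0.
  by rewrite -[r * s]/(val u) u0.
have [b] := lambda_gen _ gu0.
have [c <-] := jacobson_proj_surj b.
rewrite jacobson_proj_mul -gZ -theta_val => ltheta.
(* On the socle element [c * (r * s)], [chi] is [lambda] of the class of [c] times [g u], which
   differs from [1]. *)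
exists (c * r); rewrite -mulrA -[c * _]/(val (c *: u)).
by rewrite (chiE _ (valP (c *: u))).
Qed.

(** Orthogonality of characters: as [chi (- x)] is the inverse of [chi x], the entries of [M^T *m N]
    sum [r |-> chi (r * d)] over [R], with [d] a difference of two elements. This character is
    nontrivial for [d != 0]. *)
Lemma character_matrix_det (chi : R -> algC) : additive_character chi ->
    (forall s : R, s != 0 -> exists r, chi (r * s) != 1) ->
  \det (\matrix_(i < #|R|, j < #|R|) chi (enum_val i * enum_val j)) != 0.
Proof.
move=> [chi0 chiD] chi_gen; set M := \matrix_(i, j) _.
pose N : 'M_#|R| := \matrix_(i, j) chi (- (enum_val i * enum_val j)).
have MN : M^T *m N = (#|R|%:R)%:M.
  apply/matrixP=> i j; rewrite !mxE.
  transitivity (\sum_(r : R) chi (r * (enum_val i - enum_val j))).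
    rewrite (reindex (@enum_val _ R)) /=; last exact/onW_bij/enum_val_bij.
    by apply: eq_bigr=> k _; rewrite !mxE -chiD mulrBr.
  have [->|ij] := eqVneq i j.
    rewrite mulr1n -sum1_card natr_sum; apply: eq_bigr=> r _.
    by rewrite subrr mulr0 chi0.
  have /chi_gen[r0] : enum_val i - enum_val j != 0.
    by rewrite subr_eq0 (inj_eq enum_val_inj).
  set d := _ - _ => chi_r0; set sum := \sum_r _.
  (* Translating the summation index by [r0] multiplies the sum by [chi (r0 * d) != 1], so it
     vanishes. *)
  have shift : chi (r0 * d) * sum = sum.
    rewrite [RHS](reindex_inj (addrI r0)) mulr_sumr /=.
    by apply: eq_bigr=> r _; rewrite mulrDl chiD.
  have /eqP : (chi (r0 * d) - 1) * sum = 0 by rewrite mulrBl mul1r shift subrr.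
  by rewrite mulf_eq0 subr_eq0 (negPf chi_r0) mulr0n => /eqP.
have: \det (M^T *m N) != 0.
  rewrite MN det_scalar expf_neq0 // pnatr_eq0 -lt0n.
  by apply/card_gt0P; exists 0.
by rewrite det_mulmx det_tr mulf_eq0 negb_or => /andP[].
Qed.

End GeneratingCharacter.

(** * Change of coefficients and evaluation of the determinant *)

Section SemigroupDeterminant.
Variables (S : finType) (op : S -> S -> S).

Lemma map_semigroup_determinant (C D : comNzRingType) (f : {rmorphism C -> D}) :
  map_mpoly f (semigroup_determinant C op) = semigroup_determinant D op.
Proof.
rewrite -det_map_mx; congr (\det _); apply/matrixP=> i j.
by rewrite !mxE; apply: map_mpolyX.
Qed.

Lemma meval_semigroup_determinant (C : comNzRingType) (x : S -> C) :
  (semigroup_determinant C op).@[fun i => x (enum_val i)] =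
  \det (\matrix_(i < #|S|, j < #|S|) x (op (enum_val i) (enum_val j))).
Proof.
rewrite -det_map_mx; congr (\det _); apply/matrixP=> i j.
by rewrite !mxE [LHS]mevalXU enum_rankK.
Qed.

(** The integers embed in [F], so nonvanishing passes through [int] from [algC] to [K[i]] without
    any map between these two fields. *)
Lemma semigroup_determinant_int_eq0 (F : numDomainType) :
  (semigroup_determinant F op == 0) = (semigroup_determinant int op == 0).
Proof.
rewrite -(map_semigroup_determinant intr); apply/eqP/eqP=> [E0|->].
  apply/mpolyP=> m; apply: (@intr_inj F).
  by rewrite -mcoeff_map_mpoly E0 !mcoeff0.
by rewrite rmorph0.
Qed.

End SemigroupDeterminant.

Theorem corollary4p4 (K : realType) (R : finPzRingType) :
  frobenius_ring R -> semigroup_determinant K[i] (fun r s : R => r * s) != 0.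
Proof.
move=> /frobenius_generating_character[chi chi_add chi_gen].
rewrite semigroup_determinant_int_eq0 -(semigroup_determinant_int_eq0 _ algC).
have := character_matrix_det chi_add chi_gen; apply: contraNneq => E0.
by rewrite -(meval_semigroup_determinant _ chi) E0 meval0.
Qed.
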